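(* Let $(\mathsf X,\mathsf A,\{\mathsf A(x)\}_{x\in\mathsf X},Q,c)$ be a Markov control process with set of feasible pairs $\mathsf K$, let $w_0:\mathsf X\to[0,\infty)$ be Borel measurable, let $\mathcal R$ be a risk map on $\mathscr B_{1+w_0}$, and put $\mathcal T_{x,a}(v):=c(x,a)+\mathcal R_{x,a}(v)$. Assume there are constants $\gamma_0\in(0,1)$, $K_0>0$ and $K>K_0$ such that: (A1) $\max\{\mathcal T_{x,a}(w_0),\,-\mathcal T_{x,a}(-w_0)\}\le \gamma_0 w_0(x)+K_0$ for all $(x,a)\in\mathsf K$; (A2) $\mathcal R_{x,a}(w_0+K)-\mathcal R_{x,a}(v)+\mathcal R_{y,b}(v)-\mathcal R_{y,b}(-w_0-K)\ge 2K_0$ for all $v\in\mathscr B_{1+w_0}$ with $|v|\le w_0+K$, all $x,y\in\{x\in\mathsf X:w_0(x)\le\frac{2K_0}{1-\gamma_0}\}$, $a\in\mathsf A(x)$, $b\in\mathsf A(y)$. Set $w:=1+K^{-1}w_0$. Suppose moreover: (B1) there exist constants $\gamma\in(0,1)$, $\bar K>0$ and an upper envelope $\bar{\mathcal R}^{(w,K)}$ of $\mathcal R$ given the bound $K$ such that $\bar{\mathcal R}^{(w,K)}_{x,a}(w_0)\le\gamma w_0(x)+\bar K$ for all $(x,a)\in\mathsf K$; (B2) there exist $\alpha\in(0,1)$ and a Borel probability measure $\mu$ on $\mathsf X$ with $\int w_0\,d\mu<\infty$ such that $$\bar{\mathcal R}^{(w,K)}_{x,a}(v)-\bar{\mathcal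 R}^{(w,K)}_{x,a}(u)\ge\alpha\int(v-u)\,d\mu$$ for all $x\in\mathsf B:=\{x\in\mathsf X:w_0(x)\le R\}$, $a\in\mathsf A(x)$ and $v\ge u$ in $\mathscr B_{1+w_0}$, for some $R>\frac{2\bar K}{1-\gamma}$. Then there exist constants $\bar\alpha\in(0,1)$ and $\beta>0$ such that $$\|\mathcal R^\pi(v)-\mathcal R^\pi(u)\|_{s,1+\beta w_0}\le\bar\alpha\,\|v-u\|_{s,1+\beta w_0}\qquad\text{for all } v,u\in\mathscr B_w^{(K)},\ \pi\in\Delta.$$
   Context: Markov control process: $\mathsf X$ (states) and $\mathsf A$ (actions) are Borel spaces (Borel subsets of complete separable metric spaces); for each $x\in\mathsf X$, $\mathsf A(x)\subset\mathsf A$ is a nonempty Borel set of feasible actions; $\mathsf K:=\{(x,a):x\in\mathsf X,a\in\mathsf A(x)\}$ is a Borel subset of $\mathsf X\times\mathsf A$; $Q$ is a stochastic kernel on $\mathsf X$ given $\mathsf K$, with $Q_{x,a}(\cdot):=Q(\cdot|x,a)$; $c:\mathsf K\to\mathbb R$ is Borel measurable. $\Delta$ is the set of stochastic kernels $\pi$ on $\mathsf A$ given $\mathsf X$ with $\pi(\mathsf A(x)|x)=1$ for all $x$. Weighted spaces: for measurable $w:\mathsf X\to[1,\infty)$, $\|u\|_w:=\sup_x |u(x)|/w(x)$, $\mathscr B_w$ is the space of real-valued Borel functions on $\mathsf X$ with $\|u\|_w<\infty$, and $\|v\|_{s,w}:=\sup_{x\ne y}\frac{|v(x)-v(y)|}{w(x)+w(y)}$;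 $\mathscr B_w^{(K)}:=\{v\in\mathscr B_w:\|v\|_{s,w}\le K\}$. Note $\mathscr B_{1+\beta w_0}=\mathscr B_{1+w_0}$ for every $\beta>0$. Real numbers are identified with constant functions; $\le$ between functions is pointwise. Risk map: let $\mathscr P$ be the set of Borel probability measures on $\mathsf X$. A risk measure is $\nu:\mathscr B_w\times\mathscr P\to\mathbb R\cup\{\pm\infty\}$ such that for each $\mu\in\mathscr P$: $\nu(v,\mu)\le\nu(u,\mu)$ whenever $v\le u$; $\nu(v+r,\mu)=\nu(v,\mu)+r$ for $r\in\mathbb R$; $\nu(0,\mu)=0$. A risk map on $\mathscr B_w$ is $\mathcal R:\mathscr B_w\times\mathsf K\to\mathbb R$, written $\mathcal R_{x,a}(v)=\mathcal R(v|x,a)$, such that for each $(x,a)$ one has $\mathcal R_{x,a}(\cdot)=\nu(\cdot,Q_{x,a})$ for some risk measure $\nu$, and $(x,a)\mapsto\mathcal R(v|x,a)$ is Borel measurable for each $v$. It is coherent if each $\mathcal R_{x,a}$ is convex and satisfies $\mathcal R_{x,a}(\lambda v)=\lambda\mathcal R_{x,a}(v)$ for $\lambda\ge0$. For $\pi\in\Delta$, $\mathcal R^\pi(v)$ is the function $\mathcal R^\pi_x(v):=\int_{\mathsf A(x)}\mathcal R_{x,a}(v)\,\pi(da|x)$. Upper envelope: a coherent risk map $\bar{\mathcal R}^{(w,K)}$ on $\mathscr B_w$ is an upper envelope of $\mathcal R$ given the bound $K>0$ if $\mathcal R_{x,a}(v)-\mathcal R_{x,a}(u)\le\bar{\mathcal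 R}^{(w,K)}_{x,a}(v-u)$ for all $v,u\in\mathscr B_w^{(K)}$ and $(x,a)\in\mathsf K$. *)

(* Defs.v *)
From HB Require Import structures.
From mathcomp Require Import all_boot all_order all_algebra.
From mathcomp Require Import all_classical all_reals all_analysis.
From mathcomp Require Import measurable_realfun.

Set Implicit Arguments.
Unset Strict Implicit.
Unset Printing Implicit Defensive.

Import Order.TTheory GRing.Theory Num.Theory.
Import numFieldNormedType.Exports.

Local Open Scope classical_set_scope.
Local Open Scope ring_scope.

Definition polish_metric (R : realType) (M : metricType R) : Prop :=
  (forall F : set_system M, ProperFilter F -> cauchy F -> exists m : M, F --> m)
  /\ (exists2 D : set M, countable D & dense D).

(** A Borel space is presented as a measurable space together with the
    inclusion map [f] of its points into the ambient complete separable metric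
    space: the image is a Borel set, and the measurable sets are exactly the
    traces of the Borel sets of the ambient space. *)
Definition borel_space (R : realType) (d : measure_display)
    (T : measurableType d) : Prop :=
  exists (M : metricType R) (f : T -> M),
    [/\ polish_metric M, injective f, <<s @open M >> (range f) &
        forall B : set T,
          measurable B <-> exists2 C, <<s @open M >> C & B = f @^-1` C].

Section markov_control_process.
Context (R : realType) (dX dA : measure_display).
Context (X : measurableType dX) (A : measurableType dA).

(** [mcp_Q] and [mcp_cost] are total functions, but they are constrained, and
    will be used, on the feasible pairs only. *)
Record mcp := MCP {
  mcp_feasible : X -> set A;
  mcp_Q : X * A -> probability X R;
  mcp_cost : X * A -> R;
  mcp_states_borel : borel_space R X;
  mcp_actions_borel : borel_space R A;
  mcp_feasible_neq0 : forall x, mcp_feasible x !=set0;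
  mcp_feasible_measurable : forall x, measurable (mcp_feasible x);
  mcp_pairs_measurable : measurable [set p : X * A | mcp_feasible p.1 p.2];
  mcp_Q_measurable : forall B : set X, measurable B ->
    measurable_fun [set p : X * A | mcp_feasible p.1 p.2]
                   (mcp_Q ^~ B);
  mcp_cost_measurable :
    measurable_fun [set p : X * A | mcp_feasible p.1 p.2] mcp_cost
}.

Definition feasible_pairs (m : mcp) : set (X * A) :=
  [set p | mcp_feasible m p.1 p.2].

Definition policy (m : mcp) (pi : R.-pker X ~> A) : Prop :=
  forall x, pi x (mcp_feasible m x) = 1%E.

Definition wnorm (w u : X -> R) : \bar R :=
  ereal_sup [set (`|u x| / w x)%:E | x in [set: X]].

(** [maxe 0] only matters when [X] is a singleton, where the supremum over the
    empty set of pairs [x != y] is to be read as 0 instead of -oo. *)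
Definition wseminorm (w v : X -> R) : \bar R :=
  maxe 0%E (ereal_sup [set (`|v p.1 - v p.2| / (w p.1 + w p.2))%:E
                    | p in [set p : X * X | p.1 <> p.2]]).

Definition Bw (w : X -> R) : set (X -> R) :=
  [set u | measurable_fun [set: X] u /\ (wnorm w u < +oo)%E].

Definition BwK (w : X -> R) (K : R) : set (X -> R) :=
  [set v | Bw w v /\ (wseminorm w v <= K%:E)%E].

Definition risk_measure (w : X -> R)
    (nu : (X -> R) -> probability X R -> \bar R) : Prop :=
  forall mu : probability X R,
  [/\ forall v u, Bw w v -> Bw w u -> (forall x, v x <= u x) ->
        (nu v mu <= nu u mu)%E,
      forall v (r : R), Bw w v ->
        nu (fun x => v x + r) mu = (nu v mu + r%:E)%E
    & nu (fun=> 0) mu = 0%E].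

(** The values of [Rm v p] are meaningful for [v] in [Bw w] and [p] feasible
    only. *)
Definition risk_map (m : mcp) (w : X -> R) (Rm : (X -> R) -> X * A -> R)
    : Prop :=
  (forall p, feasible_pairs m p ->
     exists2 nu, risk_measure w nu &
       forall v, Bw w v -> (Rm v p)%:E = nu v (mcp_Q m p)) /\
  (forall v, Bw w v -> measurable_fun (feasible_pairs m) (Rm v)).

Definition coherent (m : mcp) (w : X -> R) (Rm : (X -> R) -> X * A -> R)
    : Prop :=
  forall p, feasible_pairs m p ->
    (forall v u (t : R), Bw w v -> Bw w u -> 0 <= t <= 1 ->
       Rm (fun x => t * v x + (1 - t) * u x) p
       <= t * Rm v p + (1 - t) * Rm u p) /\
    (forall v (l : R), Bw w v -> 0 <= l ->
       Rm (fun x => l * v x) p = l * Rm v p).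

Definition policy_risk (m : mcp) (Rm : (X -> R) -> X * A -> R)
    (pi : R.-pker X ~> A) (v : X -> R) : X -> R :=
  fun x => \int[pi x]_(a in mcp_feasible m x) Rm v (x, a).

Definition upper_envelope (m : mcp) (w : X -> R) (K : R)
    (Rm Rbar : (X -> R) -> X * A -> R) : Prop :=
  [/\ risk_map m w Rbar, coherent m w Rbar &
      forall v u p, BwK w K v -> BwK w K u -> feasible_pairs m p ->
        Rm v p - Rm u p <= Rbar (fun x => v x - u x) p].

End markov_control_process.

(* Main.v *)
Require Import Defs.
From HB Require Import structures.
From mathcomp Require Import all_boot all_order all_algebra.
From mathcomp Require Import all_classical all_reals all_analysis.
From mathcomp Require Import measurable_realfun.
From mathcomp Require Import ring lra.

Import Order.TTheory GRing.Theory Num.Theory.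
Import numFieldNormedType.Exports.

Local Open Scope classical_set_scope.
Local Open Scope ring_scope.

(** The upper envelope reduces the claim to a bound on
    Rbar_{x,a}(f) + Rbar_{y,b}(-f) with f := v - u, uniformly in the actions,
    which is then integrated against the policy. A function whose weighted
    seminorm is at most L is, up to an additive constant, dominated by
    L (1 + beta w0), and the constant cancels in this sum. As for Harris chains,
    the bound is a dichotomy: if w0 x + w0 y exceeds r, the drift condition (B1)
    alone contracts; otherwise x and y both lie in the small set and the
    minorization (B2) gains 2 alpha L, half of which pays for the drift constant
    once beta is small. Boundedness of a |-> R_{x,a}(v), needed for integrability,
    comes from the envelope applied to the pairs (v, 0) and (0, v). *)

(** * Integrals over a set of mass one *)

Section probability_bounds.
Context {R : realType} {d : measure_display} {T : measurableType d}.
Variables (P : {measure set T -> \bar R}) (D : set T).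
Hypotheses (mD : measurable D) (PD : P D = 1%E).

(** Mass 1 is required on [D] only, so the section serves both [mu] on all of [X] and a policy on
    the feasible actions. *)
Lemma bounded_integrable_carrier (f : T -> R) C : measurable_fun D f ->
  (forall x, D x -> `|f x| <= C) -> P.-integrable D (EFin \o f).
Proof.
move=> mf fC; apply: measurable_bounded_integrable => //.
  by rewrite PD ltry.
by exists C; split => [|M CM x Dx]; [exact: num_real|exact: le_trans (fC x Dx) (ltW CM)].
Qed.

Lemma Rintegral_carrier_cst (c : R) : \int[P]_(x in D) c = c.
Proof. by rewrite Rintegral_cst // PD mulr1. Qed.

Lemma integrable_carrier_cst (c : R) : P.-integrable D (EFin \o cst c).
Proof.
by apply: (bounded_integrable_carrier _ `|c|) => //; exact: measurable_cst.
Qed.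

Lemma Rintegral_carrier_le (f : T -> R) c : P.-integrable D (EFin \o f) ->
  (forall x, D x -> f x <= c) -> \int[P]_(x in D) f x <= c.
Proof.
move=> fi fc; rewrite -(Rintegral_carrier_cst c).
by apply: le_Rintegral => //; exact: integrable_carrier_cst.
Qed.

Lemma Rintegral_carrier_ge (f : T -> R) c : P.-integrable D (EFin \o f) ->
  (forall x, D x -> c <= f x) -> c <= \int[P]_(x in D) f x.
Proof.
move=> fi fc; rewrite -(Rintegral_carrier_cst c).
by apply: le_Rintegral => //; exact: integrable_carrier_cst.
Qed.

End probability_bounds.

(** * Weighted norms and seminorms as pointwise bounds *)

Section weighted_spaces.
Context {R : realType} {d : measure_display} {X : measurableType d}.
Implicit Types (w u v : X -> R).

Lemma BwP w u : (forall x, 0 < w x) ->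
  Bw w u <->
  measurable_fun [set: X] u /\ exists C, forall x, `|u x| <= C * w x.
Proof.
move=> w_gt0; split=> -[mu ub]; split=> //; last first.
  have [C uC] := ub; apply: (@le_lt_trans _ _ C%:E); last exact: ltry.
  by apply: ge_ereal_sup => _ [x _ <-]; rewrite lee_fin ler_pdivrMr.
have u_le x : ((`|u x| / w x)%:E <= wnorm w u)%E.
  by apply: ereal_sup_ubound; exists x.
exists (fine (wnorm w u)) => x; rewrite -ler_pdivrMr // -lee_fin fineK //.
by rewrite ge0_fin_numE // (le_trans _ (u_le x)) // lee_fin divr_ge0 // ltW.
Qed.

(** The conjunct [0 <= L] reflects [maxe 0]; pairs with x = y, absent from the supremum, have left
    side 0. *)
Lemma wseminormP w v (L : R) : (forall x, 0 < w x) ->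
  (wseminorm w v <= L%:E)%E <->
  0 <= L /\ forall x y, `|v x - v y| <= L * (w x + w y).
Proof.
move=> w_gt0; have ww_gt0 x y : 0 < w x + w y by rewrite addr_gt0.
rewrite /wseminorm ge_max lee_fin; split.
  move=> /andP[L_ge0 vL]; split=> // x y.
  have [->|/eqP xy] := eqVneq x y; first by rewrite subrr normr0 mulr_ge0 // ltW.
  rewrite -ler_pdivrMr // -lee_fin; apply: le_trans vL.
  by apply: ereal_sup_ubound; exists (x, y).
move=> [-> vL] /=; apply: ge_ereal_sup => _ [[x y] _ <-].
by rewrite lee_fin ler_pdivrMr.
Qed.

(* The supremum of v - L w lies below the infimum of v + L w, and c may be any
   number in between. *)
Lemma wseminorm_center w v (L : R) (x0 : X) :
  (forall x y, `|v x - v y| <= L * (w x + w y)) ->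
  exists c, forall x, `|v x - c| <= L * w x.
Proof.
move=> vL; pose E := range (fun x => v x - L * w x).
have ubE y : ubound E (v y + L * w y).
  move=> _ [x _ <-]; have := le_trans (ler_norm _) (vL x y); lra.
exists (sup E) => x; rewrite ler_norml.
have h1 : sup E <= v x + L * w x.
  by apply: ge_sup => //; exists (v x0 - L * w x0), x0.
have h2 : v x - L * w x <= sup E.
  by apply: ub_le_sup; [exists (v x0 + L * w x0) | exists x].
by apply/andP; split; lra.
Qed.

End weighted_spaces.

(** * Functions bounded by affine weights in [w0] *)

Section affine_weights.
Context {R : realType} {d : measure_display} {X : measurableType d}.
Variables (w0 : X -> R).
Hypothesis w0_ge0 : forall x, 0 <= w0 x.
Implicit Types (b : R) (u v : X -> R).

Lemma affine_weight_gt0 b : 0 <= b -> forall x, 0 < 1 + b * w0 x.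
Proof. by move=> b0 x; rewrite ltr_pwDl // mulr_ge0. Qed.

(** Since [w0] is nonnegative, 1 + b w0 <= (1 + b) (1 + w0) and 1 + w0 <= (1 + b^-1) (1 + b w0). *)
Lemma Bw_affineP b u : 0 < b ->
  Bw (fun x => 1 + b * w0 x) u <->
  measurable_fun [set: X] u /\ exists C, forall x, `|u x| <= C * (1 + w0 x).
Proof.
move=> b0; rewrite (BwP _ _ (affine_weight_gt0 _ (ltW b0))).
(* Enlarging the weight needs a nonnegative constant; the bound at the point considered provides
   it. *)
have C_ge0 (y C D : R) : 0 < D -> `|y| <= C * D -> 0 <= C.
  by move=> D0 /(le_trans (normr_ge0 _)); rewrite pmulr_lge0.
split=> -[mu [C uC]]; split=> //.
  exists (C * (1 + b)) => x; apply: (le_trans (uC x)).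
  have C0 := C_ge0 _ _ _ (affine_weight_gt0 _ (ltW b0) x) (uC x).
  rewrite -mulrA ler_wpM2l //; have := w0_ge0 x; nra.
exists (C * (1 + b^-1)) => x; apply: (le_trans (uC x)).
have C0 : 0 <= C by apply: C_ge0 (uC x); rewrite ltr_pwDl.
rewrite -mulrA ler_wpM2l // mulrDl mul1r mulrDr mulr1 mulKf ?gt_eqF //.
have := w0_ge0 x; have : 0 < b^-1 by rewrite invr_gt0.
nra.
Qed.

Lemma Bw1P u : Bw (fun x => 1 + w0 x) u <->
  measurable_fun [set: X] u /\ exists C, forall x, `|u x| <= C * (1 + w0 x).
Proof.
have -> : (fun x => 1 + w0 x) = (fun x => 1 + 1 * w0 x).
  by apply/funext => x; rewrite mul1r.
exact: Bw_affineP.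
Qed.

Lemma Bw_affineE b : 0 < b -> Bw (fun x => 1 + b * w0 x) = Bw (fun x => 1 + w0 x).
Proof.
by move=> b0; apply/seteqP; split=> u; rewrite Bw1P Bw_affineP.
Qed.

Local Notation B := (Bw (fun x => 1 + w0 x)).

Lemma Bw_cst (c : R) : B (fun=> c).
Proof.
apply/Bw1P; split; first exact: measurable_cst.
by exists `|c| => x; rewrite ler_peMr // lerDl.
Qed.

Lemma Bw_weight : measurable_fun [set: X] w0 -> B w0.
Proof.
move=> mw; apply/Bw1P; split => //; exists 1 => x.
by rewrite ger0_norm // mul1r lerDr.
Qed.

Lemma BwZ (c : R) u : B u -> B (fun x => c * u x).
Proof.
move=> /Bw1P[mu [C uC]]; apply/Bw1P; split.
  by apply: measurable_funM => //; exact: measurable_cst.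
by exists (`|c| * C) => x; rewrite normrM -mulrA ler_wpM2l.
Qed.

Lemma BwD u v : B u -> B v -> B (fun x => u x + v x).
Proof.
move=> /Bw1P[mu [C uC]] /Bw1P[mv [D vD]]; apply/Bw1P; split.
  exact: measurable_funD.
by exists (C + D) => x; rewrite mulrDl (le_trans (ler_normD _ _)) ?lerD.
Qed.

Lemma BwN u : B u -> B (fun x => - u x).
Proof.
move=> Bu; have -> : (fun x => - u x) = (fun x => -1 * u x).
  by apply/funext => x; rewrite mulN1r.
exact: BwZ.
Qed.

Lemma BwB u v : B u -> B v -> B (fun x => u x - v x).
Proof. by move=> Bu /BwN; exact: BwD. Qed.

(** Domination by a multiple of 1 + w0, which is integrable. *)
Lemma Bw_integrable (mu : probability X R) u :
  measurable_fun [set: X] w0 -> (\int[mu]_x (w0 x)%:E < +oo)%E ->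
  B u -> mu.-integrable [set: X] (EFin \o u).
Proof.
move=> mw w_fin /Bw1P[mu_ [C uC]].
have iw : mu.-integrable [set: X] (EFin \o w0).
  apply/integrableP; split; first exact/measurable_EFinP.
  by under eq_integral do rewrite /= ger0_norm //.
apply: (@le_integrable _ _ _ _ _ _ _ (EFin \o (fun x => C * (1 + w0 x)))) => //.
- exact/measurable_EFinP.
- by move=> x _ /=; rewrite lee_fin (le_trans (uC x)) // ler_norm.
- have i1 : mu.-integrable [set: X] (EFin \o cst 1).
    exact: finite_measure_integrable_cst.
  exact: (integrableZl measurableT C (integrableD measurableT i1 iw)).
Qed.

(** This is what remains of a risk measure once the probability measure is fixed and the values are
    real. *)
Definition monetary (F : (X -> R) -> R) : Prop :=
  [/\ forall v u, B v -> B u -> (forall x, v x <= u x) -> F v <= F u,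
      forall v c, B v -> F (fun x => v x + c) = F v + c
    & F (fun=> 0) = 0].

(** * Drift and minorization for monetary functionals *)

Section monetary_bounds.
Variable F : (X -> R) -> R.
Hypotheses (mw : measurable_fun [set: X] w0) (F_mon : monetary F).
Hypothesis F_hom : forall v l, B v -> 0 <= l -> F (fun x => l * v x) = l * F v.

Lemma monetary_affine_weight (L b : R) : 0 <= L -> 0 <= b ->
  F (fun x => L * (1 + b * w0 x)) = L * (1 + b * F w0).
Proof.
have [_ F_tr _] := F_mon => L0 b0.
have -> : (fun x => L * (1 + b * w0 x)) = (fun x => L * b * w0 x + L).
  by apply/funext => x; ring.
have Bw := Bw_weight mw.
by rewrite F_tr ?F_hom ?mulr_ge0 //; [ring | exact: BwZ].
Qed.

(** Monotonicity passes to the affine bound; translation and homogeneity then leave only [F w0],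
    which the drift condition controls. *)
Lemma monetary_le (c L b : R) f : 0 <= L -> 0 <= b -> B f ->
  (forall x, f x - c <= L * (1 + b * w0 x)) ->
  F f <= c + L * (1 + b * F w0).
Proof.
have [F_mono F_tr _] := F_mon => L0 b0 Bf f_le.
rewrite -(monetary_affine_weight _ _ L0 b0) addrC -F_tr; last first.
  by apply/BwZ/BwD; [exact: Bw_cst | exact/BwZ/Bw_weight].
apply: F_mono => // [|x]; last by have := f_le x; lra.
by apply: BwD (Bw_cst c); apply/BwZ/BwD; [exact: Bw_cst | exact/BwZ/Bw_weight].
Qed.

(** Minorization between f and its affine bound g sharpens monotonicity by alpha times the integral
    of g - f. *)
Lemma monetary_le_minorized (mu : probability X R) (alpha c L b : R) f :
  (\int[mu]_x (w0 x)%:E < +oo)%E -> 0 <= alpha -> 0 <= L -> 0 <= b -> B f ->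
  (forall u v, B u -> B v -> (forall x, v x <= u x) ->
     alpha * \int[mu]_x (u x - v x) <= F u - F v) ->
  (forall x, f x - c <= L * (1 + b * w0 x)) ->
  F f <= c + L * (1 + b * F w0) + alpha * (\int[mu]_x f x - c - L).
Proof.
have [_ F_tr _] := F_mon => w_fin al0 L0 b0 Bf F_min f_le.
pose g x := L * (1 + b * w0 x) + c.
have Bw := Bw_weight mw.
have B1 : B (fun x => L * (1 + b * w0 x)).
  by apply/BwZ/BwD; [exact: Bw_cst | exact: BwZ].
have Bg : B g by apply: BwD (Bw_cst c).
have := F_min _ _ Bg Bf; rewrite [F g]F_tr // monetary_affine_weight // => H.
have {H}H := H (fun x => ltac:(rewrite /g; have := f_le x; lra)).
rewrite RintegralB // in H; try exact: Bw_integrable.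
(* Only the constant part of g is kept, the rest being nonnegative. *)
suff : L + c <= \int[mu]_x g x by move=> /(ler_wpM2l al0); lra.
apply: (Rintegral_carrier_ge mu _ measurableT (probability_setT mu)).
  exact: Bw_integrable.
by move=> x _; rewrite /g lerD2r mulrDr mulr1 lerDl !mulr_ge0.
Qed.

End monetary_bounds.

(** [F] and [G] stand for the envelope at two feasible pairs, [s] and [t] for [w0] at their states.
    In the sum, c cancels against -c, and in the small set the integral of f against that of -f. *)
Lemma monetary_pair_contraction (mu : probability X R) (F G : (X -> R) -> R)
    (alpha gamma Kb r b eps s t L c : R) f :
  measurable_fun [set: X] w0 -> (\int[mu]_x (w0 x)%:E < +oo)%E ->
  monetary F -> (forall v l, B v -> 0 <= l -> F (fun x => l * v x) = l * F v) ->
  monetary G -> (forall v l, B v -> 0 <= l -> G (fun x => l * v x) = l * G v) ->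
  F w0 <= gamma * s + Kb -> G w0 <= gamma * t + Kb ->
  (s <= r -> forall u v, B u -> B v -> (forall x, v x <= u x) ->
     alpha * \int[mu]_x (u x - v x) <= F u - F v) ->
  (t <= r -> forall u v, B u -> B v -> (forall x, v x <= u x) ->
     alpha * \int[mu]_x (u x - v x) <= G u - G v) ->
  0 <= s -> 0 <= t -> 0 <= alpha -> 0 <= L -> 0 <= b ->
  eps <= 1 - gamma -> 2 * eps <= alpha -> 2 * (b * Kb) <= alpha ->
  eps * (2 + b * r) <= b * ((1 - gamma) * r - 2 * Kb) ->
  B f -> (forall x, `|f x - c| <= L * (1 + b * w0 x)) ->
  F f + G (fun x => - f x) <= (1 - eps) * L * (2 + b * (s + t)).
Proof.
move=> mw w_fin F_mon F_hom G_mon G_hom F_w G_w F_min G_min s0 t0 al0 L0 b0.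
move=> eps_gamma eps_al bKb eps_r Bf f_c.
have f_le x : f x - c <= L * (1 + b * w0 x) := le_trans (ler_norm _) (f_c x).
have f_ge x : - f x - - c <= L * (1 + b * w0 x).
  by rewrite opprK addrC (le_trans (ler_norm _)) // distrC.
have bFG : b * F w0 + b * G w0 <= b * (gamma * (s + t) + 2 * Kb).
  by rewrite -mulrDr ler_wpM2l //; lra.
have bst : 0 <= b * (s + t) by rewrite mulr_ge0 ?addr_ge0.
rewrite [(1 - eps) * L]mulrC -mulrA.
(* As s and t are nonnegative, s + t <= r gives both s <= r and t <= r. *)
have [st_r|r_st] := leP (s + t) r.
  have := monetary_le_minorized _ mw F_mon F_hom _ _ c _ _ _ w_fin al0 L0 b0 Bf
    (F_min ltac:(lra)) f_le.
  have := monetary_le_minorized _ mw G_mon G_hom _ _ (- c) _ _ _ w_fin al0 L0 b0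
    (BwN _ Bf) (G_min ltac:(lra)) f_ge.
  have -> : \int[mu]_x (- f x) = - \int[mu]_x f x.
    rewrite -mulN1r -RintegralZl //; last exact: Bw_integrable.
    by under eq_Rintegral do rewrite -mulN1r.
  (* The gain 2 alpha covers both 2 b Kb and the loss 2 eps on the constant 2. *)
  have H : 2 + b * F w0 + b * G w0 - 2 * alpha <= (1 - eps) * (2 + b * (s + t)).
    have := ler_wpM2r bst eps_gamma; lra.
  have := ler_wpM2l L0 H; lra.
have := monetary_le _ mw F_mon F_hom _ _ _ _ L0 b0 Bf f_le.
have := monetary_le _ mw G_mon G_hom _ _ _ _ L0 b0 (BwN _ Bf) f_ge.
(* At s + t = r the last condition on [eps] suffices; beyond r the right side grows at least as fast
   as the drift bound, because gamma <= 1 - eps. *)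
have H : 2 + b * F w0 + b * G w0 <= (1 - eps) * (2 + b * (s + t)).
  have bstr : 0 <= b * (s + t - r) by rewrite mulr_ge0 // subr_ge0 ltW.
  have := ler_wpM2r bstr eps_gamma; lra.
have := ler_wpM2l L0 H; lra.
Qed.

End affine_weights.

(** * From risk maps to monetary functionals, and the contraction *)

Lemma risk_map_monetary (R : realType) (dX dA : measure_display)
    (X : measurableType dX) (A : measurableType dA) (m : mcp R X A)
    (w0 : X -> R) (Rm : (X -> R) -> X * A -> R) p :
  (forall x, 0 <= w0 x) ->
  risk_map m (fun x => 1 + w0 x) Rm -> feasible_pairs m p ->
  monetary w0 (Rm ^~ p).
Proof.
move=> w0_ge0 [Rm_nu _] Kp; have [nu nu_risk Rm_eq] := Rm_nu p Kp.
have [nu_mono nu_tr nu_0] := nu_risk (mcp_Q m p).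
split=> [v u Bv Bu vu|v c Bv|].
- by rewrite -lee_fin !Rm_eq //; exact: nu_mono.
- apply: EFin_inj; rewrite EFinD !Rm_eq //; first exact: nu_tr.
  exact: BwD (Bw_cst _ _ _).
- by apply: EFin_inj; rewrite Rm_eq //; exact: Bw_cst.
Qed.

Theorem theorem3p14 (R : realType) (dX dA : measure_display)
  (X : measurableType dX) (A : measurableType dA) (m : mcp R X A)
  (w0 : X -> R) (w0_meas : measurable_fun [set: X] w0)
  (w0_ge0 : forall x, 0 <= w0 x)
  (Rm : (X -> R) -> X * A -> R)
  (Rm_risk : risk_map m (fun x => 1 + w0 x) Rm)
  (gamma0 K0 K : R) (gamma0_bnd : 0 < gamma0 < 1) (K0_gt0 : 0 < K0)
  (K_gt : K0 < K)
  (A1 : forall x a, feasible_pairs m (x, a) ->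
     Num.max (mcp_cost m (x, a) + Rm w0 (x, a))
             (- (mcp_cost m (x, a) + Rm (fun z => - w0 z) (x, a)))
     <= gamma0 * w0 x + K0)
  (A2 : forall (v : X -> R) x y a b,
     Bw (fun z => 1 + w0 z) v -> (forall z, `|v z| <= w0 z + K) ->
     w0 x <= 2 * K0 / (1 - gamma0) -> w0 y <= 2 * K0 / (1 - gamma0) ->
     mcp_feasible m x a -> mcp_feasible m y b ->
     2 * K0 <= Rm (fun z => w0 z + K) (x, a) - Rm v (x, a)
               + Rm v (y, b) - Rm (fun z => - w0 z - K) (y, b))
  (gamma Kbar : R) (Rbar : (X -> R) -> X * A -> R)
  (gamma_bnd : 0 < gamma < 1) (Kbar_gt0 : 0 < Kbar)
  (Rbar_env : upper_envelope m (fun x => 1 + K^-1 * w0 x) K Rm Rbar)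
  (B1 : forall x a, feasible_pairs m (x, a) ->
     Rbar w0 (x, a) <= gamma * w0 x + Kbar)
  (alpha : R) (mu : probability X R) (r : R)
  (alpha_bnd : 0 < alpha < 1)
  (mu_w0 : (\int[mu]_x (w0 x)%:E < +oo)%E)
  (r_gt : 2 * Kbar / (1 - gamma) < r)
  (B2 : forall (v u : X -> R) x a,
     w0 x <= r -> mcp_feasible m x a ->
     Bw (fun z => 1 + w0 z) v -> Bw (fun z => 1 + w0 z) u ->
     (forall z, u z <= v z) ->
     alpha * \int[mu]_z (v z - u z) <= Rbar v (x, a) - Rbar u (x, a)) :
  exists alphabar beta : R,
    [/\ 0 < alphabar < 1, 0 < beta &
      forall (v u : X -> R) (pi : R.-pker X ~> A),
        BwK (fun x => 1 + K^-1 * w0 x) K v ->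
        BwK (fun x => 1 + K^-1 * w0 x) K u ->
        policy m pi ->
        (wseminorm (fun x => 1 + beta * w0 x)%R
           (fun x => policy_risk m Rm pi v x - policy_risk m Rm pi u x)%R
         <= alphabar%:E *
            wseminorm (fun x => 1 + beta * w0 x)%R (fun x => v x - u x)%R)%E].
Proof.
have K_gt0 : 0 < K := lt_trans K0_gt0 K_gt.
have iK_gt0 : 0 < K^-1 by rewrite invr_gt0.
have [g_gt0 g_lt1] := andP gamma_bnd; have [al_gt0 al_lt1] := andP alpha_bnd.
have g1_gt0 : 0 < 1 - gamma by rewrite subr_gt0.
(* The net decrease that the drift leaves at two states with w0 x + w0 y = r. *)
have r_gap : 0 < (1 - gamma) * r - 2 * Kbar.
  by move: r_gt; rewrite ltr_pdivrMr // subr_gt0 mulrC [r * _]mulrC [Kbar * 2]mulrC.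
have r_gt0 : 0 < r.
  by apply: le_lt_trans r_gt; rewrite divr_ge0 ?mulr_ge0 // ltW.
(* The largest such [beta] is chosen: the drift constants then use exactly half of the gain 2
   alpha. *)
have [beta beta_gt0 beta_K] : exists2 beta, 0 < beta & 2 * (beta * Kbar) <= alpha.
  exists (alpha / (2 * Kbar)); first by rewrite divr_gt0 // mulr_gt0.
  by rewrite mulrCA divfK // gt_eqF // mulr_gt0.
have r_beta : 0 < 2 + beta * r by rewrite addr_gt0 // mulr_gt0.
(* The largest [eps] meeting the three conditions of the pair contraction. *)
pose eps := Num.min (Num.min (1 - gamma) (alpha / 2))
  (beta * ((1 - gamma) * r - 2 * Kbar) / (2 + beta * r)).
have eps_gt0 : 0 < eps.
  by rewrite !lt_min g1_gt0 !divr_gt0 // mulr_gt0.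
have eps_gamma : eps <= 1 - gamma by rewrite !ge_min lexx.
have eps_al : 2 * eps <= alpha.
  by rewrite mulrC -ler_pdivlMr // !ge_min lexx orbT.
have eps_r : eps * (2 + beta * r) <= beta * ((1 - gamma) * r - 2 * Kbar).
  by rewrite -ler_pdivlMr // !ge_min lexx orbT.
exists (1 - eps), beta; split=> //; first by apply/andP; split; lra.
have wb_gt0 := affine_weight_gt0 w0 w0_ge0 beta (ltW beta_gt0).
have wK_gt0 := affine_weight_gt0 w0 w0_ge0 K^-1 (ltW iK_gt0).
have [Rbar_risk Rbar_coh Rbar_up] := Rbar_env.
rewrite /risk_map /risk_measure Bw_affineE // in Rbar_risk.
rewrite /coherent Bw_affineE // in Rbar_coh.
have Rbar_mon p Kp := risk_map_monetary _ _ _ _ _ m w0 Rbar p w0_ge0 Rbar_risk Kp.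
have BwKP v : BwK (fun x => 1 + K^-1 * w0 x) K v -> Bw (fun x => 1 + w0 x) v.
  by case; rewrite Bw_affineE.
(* Comparison with 0, where [Rm] vanishes, turns the envelope inequality into bounds on [Rm v]
   itself. *)
have BwK0 : BwK (fun x => 1 + K^-1 * w0 x) K (fun=> 0).
  split; first by rewrite Bw_affineE //; exact: Bw_cst.
  apply/wseminormP => //; split=> [|x y]; first exact: ltW.
  have := wK_gt0 x; have := wK_gt0 y; rewrite subr0 normr0 => wy wx.
  by rewrite mulr_ge0 ?ltW // addr_gt0.
have Rm_bounded v x : BwK (fun x => 1 + K^-1 * w0 x) K v ->
    exists C, forall a, mcp_feasible m x a -> `|Rm v (x, a)| <= C.
  move=> Kv; have Bv := BwKP _ Kv.
  have [_ /(wseminormP _ _ _ wK_gt0)[_ vK]] := Kv.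
  have [c v_c] := wseminorm_center _ _ _ x vK.
  (* By (B1) this bounds the envelope of both v and -v, centred at c and -c, uniformly in the
     action. *)
  exists (`|c| + K * (1 + K^-1 * (gamma * w0 x + Kbar))) => a xa.
  have Kxa : feasible_pairs m (x, a) by [].
  have [_ _ Rm0] := risk_map_monetary _ _ _ _ _ _ _ _ _ w0_ge0 Rm_risk Kxa.
  have [_ Rbar_hom] := Rbar_coh _ Kxa.
  have Rbar_w : K * (1 + K^-1 * Rbar w0 (x, a))
      <= K * (1 + K^-1 * (gamma * w0 x + Kbar)).
    by rewrite ler_pM2l // lerD2l ler_pM2l //; exact: B1.
  have bound u c' : Bw (fun x => 1 + w0 x) u -> `|c'| = `|c| ->
      (forall z, `|u z - c'| <= K * (1 + K^-1 * w0 z)) ->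
      Rbar u (x, a) <= `|c| + K * (1 + K^-1 * (gamma * w0 x + Kbar)).
    move=> Bu cc u_c; apply: le_trans (lerD _ Rbar_w); last first.
      by rewrite -cc; exact: ler_norm.
    apply: (monetary_le w0 w0_ge0 (Rbar ^~ (x, a))) => //; try exact: ltW.
    - exact: Rbar_mon.
    - by move=> z; apply: le_trans (u_c z); exact: ler_norm.
  rewrite ler_norml; apply/andP; split.
    rewrite lerNl; have := Rbar_up _ _ _ BwK0 Kv Kxa; rewrite Rm0 sub0r.
    move=> /le_trans; apply; apply: (bound _ (- c)); last 2 first.
    - exact: normrN.
    - by move=> z; rewrite opprK sub0r addrC distrC.
    - exact: (BwB w0 w0_ge0 _ _ (Bw_cst w0 w0_ge0 0) Bv).
  have := Rbar_up _ _ _ Kv BwK0 Kxa; rewrite Rm0 subr0.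
  move=> /le_trans; apply; apply: (bound _ c) => [||z] //; last by rewrite subr0.
  exact: (BwB w0 w0_ge0 _ _ Bv (Bw_cst w0 w0_ge0 0)).
move=> v u pi Kv Ku pi_pol.
have Rm_int f x : BwK (fun x => 1 + K^-1 * w0 x) K f ->
    (pi x).-integrable (mcp_feasible m x) (EFin \o (fun a => Rm f (x, a))).
  move=> Kf; have [C fC] := Rm_bounded _ x Kf.
  apply: (bounded_integrable_carrier _ _ _ (pi_pol x) _ C) => //.
    exact: mcp_feasible_measurable.
  apply: (measurable_comp (mcp_pairs_measurable m)).
  - by move=> _ [a xa <-].
  - by have [_ mRm] := Rm_risk; apply: mRm; exact: BwKP.
  - exact: measurable_funTS (pair1_measurable x).
(* The seminorm is nonnegative by [maxe 0], hence real or +oo; the infinite case is trivial as 1 -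
   eps > 0. *)
have [wn_ge0|] := leP 0%E (wseminorm (fun x => 1 + beta * w0 x) (fun x => v x - u x));
  last by rewrite /wseminorm gt_max ltxx.
case E : (wseminorm _ (fun x => v x - u x)) wn_ge0 => [L||] // _; last first.
  by rewrite gt0_muley ?leey // lte_fin; lra.
rewrite -EFinM; apply/wseminormP => //.
have /(wseminormP _ _ _ wb_gt0)[L_ge0 vu_L] :
    (wseminorm (fun x => 1 + beta * w0 x)%R (fun x => v x - u x)%R <= L%:E)%E.
  by rewrite E.
split; first by rewrite mulr_ge0 //; lra.
have BwKvu : Bw (fun x => 1 + w0 x) (fun x => v x - u x).
  by apply: (BwB w0 w0_ge0); exact: BwKP.
have gap x y a b : mcp_feasible m x a -> mcp_feasible m y b ->
    (Rm v (x, a) - Rm u (x, a)) - (Rm v (y, b) - Rm u (y, b))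
    <= (1 - eps) * L * (1 + beta * w0 x + (1 + beta * w0 y)).
  move=> xa yb; have Kxa : feasible_pairs m (x, a) by [].
  have Kyb : feasible_pairs m (y, b) by [].
  have [c vu_c] := wseminorm_center (fun z => 1 + beta * w0 z)
    (fun z => v z - u z) L x vu_L.
  have := Rbar_up _ _ _ Kv Ku Kxa; have := Rbar_up _ _ _ Ku Kv Kyb.
  (* The difference at (y, b) enters with a minus sign, so the envelope is applied there to u -
     v. *)
  have -> : (fun z => u z - v z) = (fun z => - (v z - u z)).
    by apply/funext => z; rewrite opprB.
  suff : Rbar (fun z => v z - u z) (x, a) + Rbar (fun z => - (v z - u z)) (y, b)
      <= (1 - eps) * L * (2 + beta * (w0 x + w0 y)) by lra.
  apply: (monetary_pair_contraction w0 w0_ge0 mu (Rbar ^~ (x, a)) (Rbar ^~ (y, b))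
            alpha gamma Kbar r beta eps (w0 x) (w0 y) L c) => //; try exact: ltW.
  - exact: Rbar_mon.
  - by have [] := Rbar_coh _ Kxa.
  - exact: Rbar_mon.
  - by have [] := Rbar_coh _ Kyb.
  - exact: B1.
  - exact: B1.
  - by move=> xr f g Bf Bg fg; exact: B2.
  - by move=> yr f g Bf Bg fg; exact: B2.
have mF x := mcp_feasible_measurable m x.
have gapI x y : (policy_risk m Rm pi v x - policy_risk m Rm pi u x)
    - (policy_risk m Rm pi v y - policy_risk m Rm pi u y)
    <= (1 - eps) * L * (1 + beta * w0 x + (1 + beta * w0 y)).
  rewrite /policy_risk -!RintegralB //; try exact: Rm_int.
  have DI z : (pi z).-integrable (mcp_feasible m z)
      (EFin \o (fun a => Rm v (z, a) - Rm u (z, a))).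
    exact: (integrableB (mF z) (Rm_int v z Kv) (Rm_int u z Ku)).
  (* [gap] holds for each pair of actions: b is fixed first, with the integral over a held constant,
     and then a. *)
  rewrite lerBlDr -lerBlDl.
  apply: (Rintegral_carrier_ge _ _ (mF y) (pi_pol y) _ _ (DI y)) => b yb.
  rewrite lerBlDl -lerBlDr lerBlDr.
  apply: (Rintegral_carrier_le _ _ (mF x) (pi_pol x) _ _ (DI x)) => a xa.
  by rewrite -lerBlDr; exact: gap.
move=> x y; rewrite ler_norml; apply/andP; split; last exact: gapI.
(* The lower bound is [gapI] with x and y exchanged. *)
by rewrite lerNl opprB [X in _ * X]addrC; exact: gapI.
Qed.
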